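(* Let $(\mathcal{G},p,\mathcal{W})$ be a weighted framework in $\mathbb{R}^3$ on $n\ge 3$ vertices, let $\mathcal{R}=R(p,\mathcal{W})^TR(p,\mathcal{W})\in\mathbb{R}^{3n\times 3n}$ be its symmetric rigidity matrix, and let $\lambda_1\le\lambda_2\le\dots\le\lambda_{3n}$ be the eigenvalues of $\mathcal{R}$ (counted with multiplicity). Then $(\mathcal{G},p,\mathcal{W})$ is infinitesimally rigid if and only if $\lambda_7>0$.
   Context: A weighted framework in $\mathbb{R}^3$ is a triple $(\mathcal{G},p,\mathcal{W})$, where $\mathcal{G}=(\mathcal{V},\mathcal{E})$ is a finite simple undirected graph with $|\mathcal{V}|=n$ vertices $v_1,\dots,v_n$ and $|\mathcal{E}|=m$ edges $e_1,\dots,e_m$, $p:\mathcal{V}\to\mathbb{R}^3$ is a map, and $\mathcal{W}$ assigns a real scalar weight to each edge; $W\in\mathbb{R}^{m\times m}$ is the diagonal matrix whose $k$-th diagonal entry is the weight of $e_k$ (weights may be zero). The rigidity matrix $R(p)\in\mathbb{R}^{m\times 3n}$ has one row per edge and one block of three columns per vertex: the row of the edge $\{u,v\}$ has $(p(u)-p(v))^T$ in the block of $u$, $(p(v)-p(u))^T$ in the block of $v$, and zeros elsewhere (the sign convention of a row is irrelevant). The weighted rigidity matrix is $R(p,\mathcal{W})=W\,R(p)$. An unweighted framework $(\mathcal{G},p)$ is infinitesimally rigid if every assignment of velocities $\xi:\mathcal{V}\to\mathbb{R}^3$ with $(\xi(u)-\xi(v))^T(p(u)-p(v))=0$ for all $\{u,v\}\in\mathcal{E}$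 is trivial, i.e. is the velocity field of a global rotation and translation: there are $\omega,c\in\mathbb{R}^3$ with $\xi(u)=\omega\times p(u)+c$ for all $u\in\mathcal{V}$. The unweighted counterpart of $(\mathcal{G},p,\mathcal{W})$ is the framework $(\hat{\mathcal{G}},p)$ with $\hat{\mathcal{G}}=(\mathcal{V},\hat{\mathcal{E}})$, where $\hat{\mathcal{E}}\subseteq\mathcal{E}$ consists of the edges with nonzero weight. A weighted framework is called infinitesimally rigid if its unweighted counterpart is infinitesimally rigid. *)

(* Defs.v *)
From HB Require Import structures.
From mathcomp Require Import all_boot all_order all_algebra.
From mathcomp Require Import reals.

Set Implicit Arguments.
Unset Strict Implicit.
Unset Printing Implicit Defensive.

Import Order.TTheory GRing.Theory Num.Theory.
Local Open Scope ring_scope.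

Record sgraph (n : nat) := SGraph {
  edges : {set {set 'I_n}};
  edges_card2 : forall e, e \in edges -> #|e| = 2%N
}.

Record framework (R : realType) (n : nat) := Framework {
  graph : sgraph n;
  pos : 'I_n -> 'cV[R]_3
}.

(* Only the values of [wweight] on the edges of [wgraph] are ever used. *)
Record wframework (R : realType) (n : nat) := WFramework {
  wgraph : sgraph n;
  wpos : 'I_n -> 'cV[R]_3;
  wweight : {set 'I_n} -> R
}.

(* Indices in 'I_3 are added modulo 3. *)
Definition cross (R : realType) (x y : 'cV[R]_3) : 'cV[R]_3 :=
  \col_i (x (i + 1) 0 * y (i + 2) 0 - x (i + 2) 0 * y (i + 1) 0).

Definition inf_rigid (R : realType) (n : nat) (F : framework R n) : Prop :=
  forall xi : 'I_n -> 'cV[R]_3,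
    (forall u v : 'I_n, [set u; v] \in edges (graph F) ->
       (xi u - xi v)^T *m (pos F u - pos F v) = 0) ->
    exists omega c : 'cV[R]_3, forall u, xi u = cross omega (pos F u) + c.

Section Weighted.
Variables (R : realType) (n : nat) (F : wframework R n).

Lemma nonzero_edges_card2 e :
  e \in [set e in edges (wgraph F) | wweight F e != 0] -> #|e| = 2%N.
Proof. by rewrite inE => /andP[/edges_card2]. Qed.

Definition unweighted : framework R n :=
  Framework (SGraph nonzero_edges_card2) (wpos F).

Definition winf_rigid : Prop := inf_rigid unweighted.

Definition nb_edges : nat := #|edges (wgraph F)|.

Definition edge (k : 'I_nb_edges) : {set 'I_n} := enum_val k.

(* The three columns of vertex [w] are the [mxvec_index w a], [a : 'I_3].  If
   [edge k] is {w, v} with v <> w, the inner sum has the single term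
   p(w) - p(v), so that the block of either endpoint gets its usual value. *)
Definition rigidity_mx : 'M[R]_(nb_edges, n * 3) :=
  \matrix_(k < nb_edges) mxvec (\matrix_(w < n)
    if w \in edge k then \sum_(v in edge k :\ w) (wpos F w - wpos F v)^T
    else 0).

Definition weight_mx : 'M[R]_nb_edges :=
  diag_mx (\row_k wweight F (edge k)).

Definition wrigidity_mx : 'M[R]_(nb_edges, n * 3) := weight_mx *m rigidity_mx.

Definition sym_rigidity_mx : 'M[R]_(n * 3) := wrigidity_mx^T *m wrigidity_mx.

End Weighted.

(* Nondecreasing list of all eigenvalues, with algebraic multiplicity. *)
Definition is_spectrum (R : realType) (N : nat) (A : 'M[R]_N)
    (lambda : N.-tuple R) : Prop :=
  sorted <=%R lambda /\ char_poly A = \prod_(x <- lambda) ('X - x%:P).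

(* Main.v *)
(* The matrix of the theorem is a Gram matrix A^T A, with A the weighted rigidity
   matrix, so its eigenvalues are nonnegative and 0 has multiplicity dim ker A;
   thus the seventh eigenvalue is positive iff dim ker A <= 6. The kernel of A is
   the space of infinitesimal motions and contains the image T of the linear map
   sending (omega, c) to the trivial motion omega x p + c. Rigidity says that
   ker A is contained in T, whence dim ker A <= 6. Conversely, unless the points
   are collinear, dim T = 6 and dim ker A <= 6 forces ker A = T; if they are
   collinear, then rank A <= n - 1, so that dim ker A >= 2n + 1 >= 7. *)
Require Import Defs.
From HB Require Import structures.
From mathcomp Require Import all_boot all_order all_algebra.
From mathcomp Require Import reals.
From mathcomp Require Import zify ring.

Set Implicit Arguments.
Unset Strict Implicit.
Unset Printing Implicit Defensive.

Import Order.TTheory GRing.Theory Num.Theory.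
Local Open Scope ring_scope.

(** * Gram matrices: kernel, characteristic polynomial, spectrum *)

Lemma gram_eq0 (R : realType) m n (M : 'M[R]_(m, n)) : M *m M^T = 0 -> M = 0.
Proof.
move=> MM0; apply/matrixP => i j; rewrite mxE.
have /eqP : (M *m M^T) i i = 0 by rewrite MM0 mxE.
rewrite mxE psumr_eq0 => [/allP /(_ j)|k _]; last by rewrite mxE -expr2 sqr_ge0.
by rewrite mem_index_enum mxE -expr2 sqrf_eq0 => /(_ isT)/eqP.
Qed.

Lemma mulmx_gram_eq0 (R : realType) m n p (A : 'M[R]_(m, n)) (v : 'M[R]_(p, n)) :
  v *m (A^T *m A) = 0 -> v *m A^T = 0.
Proof.
move=> vS; apply: gram_eq0.
by rewrite trmx_mul trmxK mulmxA -(mulmxA v) vS mul0mx.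
Qed.

(** For an eigenvector [v], the squared norm of [v *m A^T] is [x] times that of [v]. *)
Lemma gram_eigenvalue_ge0 (R : realType) m n (A : 'M[R]_(m, n)) x :
  eigenvalue (A^T *m A) x -> 0 <= x.
Proof.
have sq_ge0 k (u : 'rV[R]_k) : 0 <= (u *m u^T) 0 0.
  by rewrite mxE sumr_ge0 // => i _; rewrite mxE -expr2 sqr_ge0.
case/eigenvalueP => v vS v0.
have vv_gt0 : 0 < (v *m v^T) 0 0.
  rewrite lt_def sq_ge0 andbT; apply: contraNneq v0 => vv0.
  by apply/eqP/gram_eq0/matrixP => i j; rewrite !ord1 vv0 mxE.
have := sq_ge0 _ (v *m A^T).
rewrite trmx_mul trmxK mulmxA -(mulmxA v) vS -scalemxAl mxE.
by rewrite pmulr_lge0.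
Qed.

Lemma char_poly_similar (F : fieldType) n (P A B : 'M[F]_n) :
  P \in unitmx -> P *m A = B *m P -> char_poly A = char_poly B.
Proof.
move=> uP PA; rewrite /char_poly.
have : map_mx polyC P *m char_poly_mx A = char_poly_mx B *m map_mx polyC P.
  by rewrite /char_poly_mx mulmxBr mulmxBl -!map_mxM PA scalar_mxC.
move/(congr1 determinant); rewrite !det_mulmx mulrC => /mulIf; apply.
by rewrite det_map_mx polyC_eq0 -unitfE -unitmxE.
Qed.

(** In the basis formed by the rows of [U] and [V], [S] becomes block diagonal with blocks 0 and
    [B]. *)
Lemma char_poly_ker_block (F : fieldType) a b n (U : 'M[F]_(a, n))
    (V : 'M[F]_(b, n)) (S : 'M[F]_n) (B : 'M[F]_b) :
  (a + b = n)%N -> row_free (col_mx U V) -> U *m S = 0 -> V *m S = B *m V ->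
  char_poly S = 'X^a * char_poly B.
Proof.
move=> eab; subst n => fP US VS.
rewrite (@char_poly_similar _ _ (col_mx U V) S (block_mx 0 0 0 B)).
- rewrite /char_poly char_block_diag_mx det_ublock.
  by rewrite {1}/char_poly_mx map_mx0 subr0 det_scalar.
- by rewrite -row_free_unit.
- by rewrite mul_col_mx mul_block_col US VS !mul0mx !add0r.
Qed.

(* A Gram matrix is injective on its row space, hence block diagonalizes as 0 on
   its kernel and an invertible matrix on its row space. *)
Lemma mup0_char_poly_gram (R : realType) m n (A : 'M[R]_(m, n)) :
  mup 0 (char_poly (A^T *m A)) = \rank (kermx A^T).
Proof.
set S := A^T *m A.
have kerS : (kermx S :=: kermx A^T)%MS.
  apply/eqmxP/andP; split; apply/sub_kermxP.
    by apply: mulmx_gram_eq0; rewrite mulmx_ker.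
  by rewrite mulmxA mulmx_ker mul0mx.
have capS : (S :&: kermx S)%MS = 0.
  apply/eqP/rowV0P => v; rewrite sub_capmx kerS => /andP[/submxP[w ->]].
  move=> /sub_kermxP; rewrite /S mulmxA -mulmxA.
  (* With [A^T] in the role of [A]: w A^T (A A^T) = 0 gives w A^T A = 0. *)
  by have := @mulmx_gram_eq0 _ _ _ _ A^T (w *m A^T); rewrite trmxK; apply.
have rkS : (\rank (kermx S) + \rank S = n)%N.
  by rewrite mxrank_ker subnK // rank_leq_row.
have [B VS] : exists B, row_base S *m S = B *m row_base S.
  by apply/submxP; rewrite eq_row_base submxMl.
(* By rank-nullity and [capS], [row_base S *m S] keeps the rank of [S]; it equals [B *m row_base S],
   so [B] has full rank. *)
have uB : B \in unitmx.
  rewrite -row_free_unit /row_free eqn_leq rank_leq_row /=.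
  have := mxrank_mul_ker (row_base S) S.
  rewrite (cap_eqmx (eq_row_base S) (eqmx_refl (kermx S))) capS mxrank0 addn0.
  rewrite VS eq_row_base => rkB.
  by rewrite -[leqLHS]rkB mxrankM_maxl.
have free : row_free (col_mx (row_base (kermx S)) (row_base S)).
  rewrite /row_free -addsmxE.
  rewrite (adds_eqmx (eq_row_base (kermx S)) (eq_row_base S)).
  by rewrite mxrank_disjoint_sum // capmxC.
rewrite (char_poly_ker_block rkS free _ VS); last first.
  by apply/sub_kermxP; rewrite eq_row_base.
rewrite mupMl; last first.
  rewrite -eigenvalue_root_char; apply/eigenvalueP => -[v vB].
  rewrite scale0r in vB; case/eqP.
  by rewrite -(mulmxK uB v) vB mul0mx.
by rewrite -kerS -['X]subr0 -polyC0 mup_XsubCX eqxx.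
Qed.

(** The zeros come first: removing a zero head shifts both sides by one, and after a positive head
    no zero can occur. *)
Lemma sorted_nth_gt0 (R : realDomainType) (s : seq R) k :
  sorted <=%R s -> {in s, forall x, 0 <= x} -> (k < size s)%N ->
  (0 < s`_k) = (count_mem 0%R s <= k)%N.
Proof.
elim: s k => //= x s IHs k sx s0 ks.
have sorted_s := path_sorted sx.
have xle : {in s, forall y, x <= y}.
  by apply/allP; apply: order_path_min sx; apply: le_trans.
have s0' : {in s, forall y, 0 <= y}.
  by move=> y ys; apply: s0; rewrite inE ys orbT.
have := s0 x (mem_head _ _); rewrite le_eqVlt => /predU1P[<-|x0].
  rewrite eqxx add1n; case: k ks => [|k] ks; first by rewrite /= ltxx.
  by rewrite ltnS -IHs.
have /count_memPn -> : 0 \notin s.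
  by apply/negP => /xle; rewrite leNgt x0.
rewrite gt_eqF // leq0n; case: k ks => //= k ks.
exact/(lt_le_trans x0)/xle/mem_nth.
Qed.

Lemma gram_spectrum_gt0 (R : realType) m n (A : 'M[R]_(m, n))
    (lambda : n.-tuple R) k :
  is_spectrum (A^T *m A) lambda -> (k < n)%N ->
  (0 < lambda`_k) = (\rank (kermx A^T) <= k)%N.
Proof.
move=> [sl pl] kn.
rewrite sorted_nth_gt0 ?size_tuple //; last first.
  move=> x xl; apply: (@gram_eigenvalue_ge0 _ _ _ A).
  by rewrite eigenvalue_root_char pl root_prod_XsubC.
by rewrite -mup0_char_poly_gram pl mu_prod_XsubC.
Qed.

(** * Sums over edges and cross products in coordinates *)

Lemma mxvec_dot (R : comNzRingType) m n (A B : 'M[R]_(m, n)) :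
  (mxvec A *m (mxvec B)^T) 0 0 = \sum_i \sum_j A i j * B i j.
Proof.
rewrite mxE pair_big /= (reindex _ (curry_mxvec_bij m n)).
by apply: eq_bigr => -[i j] _; rewrite mxE !mxvecE.
Qed.

(** Collapses the vertex-by-vertex encoding of a row of [rigidity_mx] to the two endpoints of its
    edge. *)
Lemma sum_edge (V : nmodType) n (e : {set 'I_n}) (u v : 'I_n)
    (g : 'I_n -> 'I_n -> V) :
  e = [set u; v] -> u != v ->
  \sum_(w in e) \sum_(x in e :\ w) g w x = g u v + g v u.
Proof.
move=> -> uv; rewrite big_setU1 ?inE //= big_set1.
have -> : [set u; v] :\ u = [set v].
  by apply/setP => x; rewrite !inE; case: (eqVneq x u) uv => // -> /negPf ->.
have -> : [set u; v] :\ v = [set u].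
  apply/setP => x; rewrite !inE; case: (eqVneq x v) => [->|]; last by rewrite orbF.
  by rewrite eq_sym (negPf uv).
by rewrite !big_set1.
Qed.

Lemma sum_ord3 (V : nmodType) (f : 'I_3 -> V) :
  \sum_i f i = f 0 + f 1 + f 2.
Proof.
rewrite !big_ord_recl big_ord0 addr0 addrA.
by congr (f _ + f _ + f _); apply: val_inj.
Qed.

Lemma add_ord3 : (((0 + 1 = 1 :> 'I_3)%R * (0 + 2 = 2 :> 'I_3)%R) *
  ((1 + 1 = 2 :> 'I_3)%R * (1 + 2 = 0 :> 'I_3)%R) *
  ((2 + 1 = 0 :> 'I_3)%R * (2 + 2 = 1 :> 'I_3)%R))%type.
Proof. by do !split; apply: val_inj. Qed.

Lemma crossB (R : realType) (w x y : 'cV[R]_3) :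
  cross w (x - y) = cross w x - cross w y.
Proof.
apply/colP => i; rewrite !mxE.
by move: (w _ _) (w _ _) (x _ _) (x _ _) (y _ _) (y _ _) => *; ring.
Qed.

Lemma cross0x (R : realType) (x : 'cV[R]_3) : cross 0 x = 0.
Proof. by apply/colP => i; rewrite !mxE !mul0r subrr. Qed.

Lemma cross_dot0 (R : realType) (w d : 'cV[R]_3) : (cross w d)^T *m d = 0.
Proof.
apply/matrixP => i j; rewrite !ord1 mxE sum_ord3 !mxE !add_ord3.
by move: (w _ _) (w _ _) (w _ _) (d _ _) (d _ _) (d _ _) => *; ring.
Qed.

(** Up to sign, the coordinates of the cross product are the 2 by 2 minors of the matrix with
    columns [w] and [d]. *)
Lemma cross_eq0 (R : realType) (w d : 'cV[R]_3) i j :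
  cross w d = 0 -> w i 0 * d j 0 = w j 0 * d i 0.
Proof.
move/colP => e.
have /eqP := e 0; have /eqP := e 1; have /eqP := e 2.
rewrite !mxE !add_ord3 !subr_eq0 => /eqP e01 /eqP e20 /eqP e12.
have ord3 (k : 'I_3) : [\/ k = 0, k = 1 | k = 2].
  by case: k => [[|[|[|k]]] lek] //;
    [apply: Or31 | apply: Or32 | apply: Or33]; apply: val_inj.
by case: (ord3 i) => ->; case: (ord3 j) => ->.
Qed.

(** * Infinitesimal motions and trivial motions *)

Section Framework.
Variables (R : realType) (n : nat) (F : wframework R n).

(** Flattened by [mxvec] like the rows of [rigidity_mx]; a row vector, since [kermx] is a left
    kernel. *)
Definition velocity_row (xi : 'I_n -> 'cV[R]_3) : 'rV[R]_(n * 3) :=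
  mxvec (\matrix_u (xi u)^T).

Lemma velocity_rowP (x : 'rV[R]_(n * 3)) : exists xi, x = velocity_row xi.
Proof.
exists (fun u => (row u (vec_mx x))^T); rewrite -[x in LHS]vec_mxK.
by congr mxvec; apply/row_matrixP => u; rewrite rowK trmxK.
Qed.

Lemma velocity_row_inj xi zeta :
  velocity_row xi = velocity_row zeta -> forall u, xi u = zeta u.
Proof.
move/(can_inj mxvecK)/row_matrixP => e u.
by have := e u; rewrite !rowK => /trmx_inj.
Qed.

Lemma edgeP (k : 'I_(nb_edges F)) :
  exists u v, edge k = [set u; v] /\ u != v.
Proof.
have /cards2P[u [v [uv e]]] : #|edge k| == 2%N.
  by apply/eqP/(edges_card2 (s := wgraph F)); apply: enum_valP.
by exists u, v; split.
Qed.

Lemma rigidity_mx_dot xi (k : 'I_(nb_edges F)) u v :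
  edge k = [set u; v] -> u != v ->
  (velocity_row xi *m (wrigidity_mx F)^T) 0 k =
  wweight F (edge k) * ((xi u - xi v)^T *m (wpos F u - wpos F v)) 0 0.
Proof.
move=> ek uv.
have -> : (velocity_row xi *m (wrigidity_mx F)^T) 0 k =
   wweight F (edge k) * (velocity_row xi *m (row k (rigidity_mx F))^T) 0 0.
  rewrite /wrigidity_mx /weight_mx mul_diag_mx !mxE mulr_sumr.
  by apply: eq_bigr => j _; rewrite !mxE mulrCA.
congr (_ * _); rewrite rowK mxvec_dot.
transitivity (\sum_(w in edge k) \sum_(x in edge k :\ w)
   ((xi w)^T *m (wpos F w - wpos F x)) 0 0).
  rewrite [RHS]big_mkcond; apply: eq_bigr => w _ /=.
  case: ifP => we; last first.
    by apply: big1 => j _; rewrite !mxE we !mxE mulr0.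
  rewrite -summxE -mulmx_sumr mxE; apply: eq_bigr => j _.
  rewrite !mxE we; congr (_ * _).
  by rewrite !summxE; apply: eq_bigr => x _; rewrite !mxE.
(* The blocks of [u] and [v] pair [xi u] and [xi v] with opposite edge vectors. *)
rewrite (sum_edge _ ek uv) -[wpos F v - _]opprB mulmxN.
by rewrite [(xi u - xi v)^T]linearB mulmxBl [RHS]mxE.
Qed.

(** An edge of weight 0 gives a zero row, and a nonzero weight can be cancelled from its
    equation. *)
Lemma velocity_row_ker xi :
  (velocity_row xi *m (wrigidity_mx F)^T = 0) <->
  (forall u v : 'I_n, [set u; v] \in edges (graph (unweighted F)) ->
     (xi u - xi v)^T *m (wpos F u - wpos F v) = 0).
Proof.
split=> [ker u v | dot0].
  rewrite inE => /andP[euv wuv].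
  have uv : u != v.
    by have := edges_card2 euv; rewrite cards2; case: eqP.
  have ek : edge (enum_rank_in euv [set u; v]) = [set u; v].
    by rewrite /edge enum_rankK_in.
  have /eqP := rigidity_mx_dot xi ek uv.
  rewrite ker ek mxE eq_sym mulf_eq0 (negPf wuv) => /eqP dot0.
  by apply/matrixP => i j; rewrite !ord1 dot0 mxE.
apply/rowP => k; have [u [v [ek uv]]] := edgeP k.
rewrite (rigidity_mx_dot xi ek uv) [RHS]mxE.
have [-> | w0] := eqVneq (wweight F (edge k)) 0; first by rewrite mul0r.
rewrite dot0 ?mxE ?mulr0 // -ek inE w0 andbT; exact: enum_valP.
Qed.

(** Packing (omega, c) into one row of length 3 + 3 makes the trivial motions the row space of a
    matrix with 6 rows. *)
Definition trivial_row (y : 'rV[R]_(3 + 3)) : 'rV[R]_(n * 3) :=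
  velocity_row (fun u => cross (lsubmx y)^T (wpos F u) + (rsubmx y)^T).

Fact trivial_row_linear : linear trivial_row.
Proof.
move=> a x y; rewrite /trivial_row /velocity_row -linearP; congr mxvec.
apply/matrixP => u j; rewrite !mxE.
set x1 := x 0 _; set x2 := x 0 _; set x3 := x 0 _.
set y1 := y 0 _; set y2 := y 0 _; set y3 := y 0 _.
by move: x1 x2 x3 y1 y2 y3 (wpos F u _ _) (wpos F u _ _) => /= *; ring.
Qed.
HB.instance Definition _ :=
  GRing.isLinear.Build R _ _ _ trivial_row trivial_row_linear.

Lemma trivial_row_ker y : trivial_row y *m (wrigidity_mx F)^T = 0.
Proof.
apply/velocity_row_ker => u v _.
rewrite opprD addrACA subrr addr0 -crossB.
exact: cross_dot0.
Qed.

Lemma winf_rigidP :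
  winf_rigid F <-> (kermx (wrigidity_mx F)^T <= lin1_mx trivial_row)%MS.
Proof.
split=> [rigid | sub xi dot0].
  apply/rV_subP => x /sub_kermxP; have [xi ->] := velocity_rowP x.
  move=> /velocity_row_ker /rigid [w [c xiE]].
  apply/submxP; exists (row_mx w^T c^T); rewrite mul_rV_lin1 /=.
  congr mxvec; apply/row_matrixP => u.
  by rewrite !rowK row_mxKl row_mxKr !trmxK xiE.
have /submxP[y] : (velocity_row xi <= lin1_mx trivial_row)%MS.
  by apply: submx_trans sub; apply/sub_kermxP/velocity_row_ker.
rewrite mul_rV_lin1 => /velocity_row_inj xiE.
by exists (lsubmx y)^T, (rsubmx y)^T.
Qed.

(** If a nonzero (omega, c) gives the zero motion, then omega is nonzero, since omega = 0 forces c =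
    0 at any vertex; all differences of points are then parallel to omega. *)
Lemma rank_trivial_row :
  (0 < n)%N ->
  (exists (w : 'cV[R]_3) (t : 'I_n -> R),
     forall u v, wpos F u - wpos F v = (t u - t v) *: w) \/
  \rank (lin1_mx trivial_row) = 6%N.
Proof.
move=> n_gt0; have [free | ] := boolP (row_free (lin1_mx trivial_row)).
  by right; apply/eqP.
rewrite -kermx_eq0 => /rowV0Pn[y /sub_kermxP].
rewrite mul_rV_lin1 /= -[0 in RHS](linear0 mxvec) => ker y0; left.
have {}ker u : cross (lsubmx y)^T (wpos F u) + (rsubmx y)^T = 0.
  have /row_matrixP/(_ u) := can_inj mxvecK ker.
  by rewrite rowK row0 -trmx0 => /trmx_inj.
have cross_sub u v : cross (lsubmx y)^T (wpos F u - wpos F v) = 0.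
  by apply/eqP; rewrite crossB subr_eq0 -(inj_eq (addIr (rsubmx y)^T)) !ker.
have w0 : (lsubmx y)^T != 0.
  apply: contraNneq y0 => w0.
  have := ker (Ordinal n_gt0); rewrite w0 cross0x add0r => c0.
  by rewrite -[y]hsubmxK -[lsubmx y]trmxK w0 -[rsubmx y]trmxK c0 !trmx0 row_mx0.
move: (lsubmx y)^T w0 cross_sub => w /cV0Pn[i wi] cross_sub.
(* The parameter along the line is read off a coordinate [i] where [w] does not vanish. *)
exists w, (fun u => wpos F u i 0 / w i 0) => u v.
apply/colP => j; apply: (mulfI wi).
rewrite (cross_eq0 i j (cross_sub u v)) !mxE.
by field.
Qed.

(* For points on a line of direction w, the rows of the rigidity matrix are those
   of the one-dimensional framework t tensored with w^T, and the latter rows are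
   orthogonal to the constant vectors. *)
Lemma rank_rigidity_collinear (w : 'cV[R]_3) (t : 'I_n -> R) :
  (0 < n)%N ->
  (forall u v, wpos F u - wpos F v = (t u - t v) *: w) ->
  (\rank (wrigidity_mx F) < n)%N.
Proof.
move=> n_gt0 line.
pose B : 'M[R]_(nb_edges F, n) := \matrix_(k, u)
  if u \in edge k then \sum_(v in edge k :\ u) (t u - t v) else 0.
pose D : 'M[R]_(n, n * 3) := \matrix_u mxvec (delta_mx u 0 *m w^T).
have RBD : rigidity_mx F = B *m D.
  apply/matrixP => k j; case/mxvec_indexP: j => u a.
  rewrite !mxE mxvecE mxE [RHS](bigD1 u) //= [X in _ + X]big1 ?addr0 => [|v vu]; last first.
    by rewrite !mxE mxvecE mxE big_ord1 !mxE eq_sym (negPf vu) mul0r mulr0.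
  rewrite !mxE mxvecE mxE big_ord1 !mxE !eqxx mul1r.
  case: ifP => _; last by rewrite mxE mul0r.
  rewrite summxE mulr_suml; apply: eq_bigr => v _.
  by rewrite mxE line mxE.
have B1 : B *m const_mx 1 = 0 :> 'cV_(nb_edges F).
  apply/matrixP => k j; have [u [v [ek uv]]] := edgeP k.
  rewrite !mxE; transitivity (\sum_(u in edge k) \sum_(v in edge k :\ u) (t u - t v)).
    by rewrite [RHS]big_mkcond; apply: eq_bigr => x _; rewrite !mxE mulr1.
  by rewrite (sum_edge _ ek uv) -opprB addrC subrr.
have := mulmx0_rank_max B1.
have -> : \rank (const_mx 1 : 'cV[R]_n) = 1%N.
  apply/eqP; rewrite eqn_leq rank_leq_col lt0n mxrank_eq0.
  apply/eqP => /matrixP/(_ (Ordinal n_gt0) 0)/eqP.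
  by rewrite !mxE oner_eq0.
rewrite addn1; apply: leq_ltn_trans.
by rewrite /wrigidity_mx RBD (leq_trans (mxrankM_maxr _ _)) ?mxrankM_maxl.
Qed.

End Framework.

(* Entries of a sequence are numbered from 0: lambda`_6 is the 7th one. *)
Theorem mainTheorem1 (R : realType) (n : nat) (hn : (3 <= n)%N)
    (F : wframework R n) (lambda : (n * 3).-tuple R)
    (hlambda : is_spectrum (sym_rigidity_mx F) lambda) :
  winf_rigid F <-> 0 < lambda`_6.
Proof.
have n_gt0 : (0 < n)%N by apply: leq_trans hn.
rewrite (gram_spectrum_gt0 hlambda); last lia.
rewrite winf_rigidP; split=> [sub | rk_ker].
  exact: leq_trans (mxrankS sub) (rank_leq_row _).
case: (rank_trivial_row F n_gt0) => [[w [t line]] | rk_triv].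
  have := rank_rigidity_collinear n_gt0 line.
  (* Collinear points would give 3n <= 6 + rank A <= 6 + (n - 1), impossible for n >= 3. *)
  move: rk_ker; rewrite mxrank_ker mxrank_tr leq_subLR; lia.
have sub : (lin1_mx (trivial_row F) <= kermx (wrigidity_mx F)^T)%MS.
  apply/rV_subP => x /submxP[y ->]; rewrite mul_rV_lin1.
  exact/sub_kermxP/trivial_row_ker.
(* Given [sub], the reverse inclusion amounts to an inequality of ranks. *)
by rewrite -(geq_leqif (mxrank_leqif_sup sub)) rk_triv.
Qed.
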